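(* For any compact set $E \subset \mathbb{R}^2$ and $\varepsilon>0$, the boundary $\partial E_\varepsilon$ contains at most a countably infinite number of wedges (type S1), sharp singularities (types S2, S3, S8), one-sided shallow singularities (type S4) and one-sided chain singularities (type S6).
   Context: $B_r(x)$ is the open Euclidean ball and $E_\varepsilon := \overline{\bigcup_{p \in E} B_\varepsilon(p)}$. For $x \in \partial E_\varepsilon$ the set of contributors is $\Pi_E(x) = \{y \in \partial E : \|y-x\| = \varepsilon\}$, and $\mathrm{Unp}_\varepsilon(E) := \{x \in \partial E_\varepsilon : \Pi_E(x) \text{ is a singleton}\}$. A point $x \in \partial E_\varepsilon$ is smooth if there is $r>0$ with $\partial E_\varepsilon \cap B_r(x) \subset \mathrm{Unp}_\varepsilon(E)$; otherwise it is a singularity, and $S(E_\varepsilon)$ denotes the set of singularities. A vector $\xi \in S^1$ is an outward direction at $x$ if there is a sequence $(x_n) \subset \mathbb{R}^2 \setminus E_\varepsilon$ with $x_n \to x$ and $(x_n - x)/\|x_n - x\| \to \xi$; the set of these is $\Xi_x(E_\varepsilon)$. If $\xi \in \Xi_x(E_\varepsilon)$ and $y \in \Pi_E(x)$ satisfy $\langle y - x, \xi\rangle = 0$, then $\xi$ is an extremal outward direction and $y$ an extremal contributor at $x$; the sets of these are $\Xi_x^{\mathrm{ext}}(E_\varepsilon)$ and $\Pi_E^{\mathrm{ext}}(x)$. Each of these two sets has one or two elements; write $\Xi_x^{\mathrm{ext}}(E_\varepsilon) = \{\xi_1,\xi_2\}$, allowing $\xi_1=\xi_2$, and similarly $\Pi_E^{\mathrm{ext}}(x_n)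 = \{y_n^{(1)}, y_n^{(2)}\}$, possibly with equal elements. For $v \in S^1$ let $U_r(x,v) := \{z \in B_r(x) : \langle z - x, v\rangle > 0\}$. A singularity $x\in S(E_\varepsilon)$ is (with a suitable labelling of $\xi_1,\xi_2$): S1 (wedge): if $\xi_1 \notin \{\xi_2, -\xi_2\}$. S2 (one-sided sharp singularity): if $\xi_1 = \xi_2$ and $B_\delta(x) \setminus E_\varepsilon$ is connected for some $\delta>0$. S3 (sharp-sharp singularity): if $x \notin \mathrm{Unp}_\varepsilon(E)$, $\xi_1 = -\xi_2$, and for each $i \in \{1,2\}$ there is $\delta_i>0$ for which $U_{\delta_i}(x,\xi_i) \setminus E_\varepsilon$ is connected. S4 (one-sided shallow singularity): if $x \in \mathrm{Unp}_\varepsilon(E)$, $U_{\delta_1}(x,\xi_1)\cap \partial E_\varepsilon \subset \mathrm{Unp}_\varepsilon(E)$ for some $\delta_1>0$, and $U_{\delta_2}(x,\xi_2)\cap \partial E_\varepsilon \not\subset \mathrm{Unp}_\varepsilon(E)$ for all $\delta_2>0$. S6 (one-sided chain singularity): if $\xi_1=\xi_2$ and there is a sequence $(x_n) \subset S(E_\varepsilon)\setminus\{x\}$ with $x_n \to x$ and $\left\langle \frac{y_n^{(1)}-x_n}{\varepsilon}, \frac{y_n^{(2)}-x_n}{\varepsilon}\right\rangle \to -1$, where $\{y_n^{(1)},y_n^{(2)}\} = \Pi_E^{\mathrm{ext}}(x_n)$. S8 (sharp-chain singularity): if $\xi_1=-\xi_2$, there is $\delta_1>0$ for which $U_{\delta_1}(x,\xi_1)\setminus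 E_\varepsilon$ is connected, and there are $\delta_2>0$ and a sequence $(x_n) \subset U_{\delta_2}(x,\xi_2)\cap S(E_\varepsilon)$ with $x_n\to x$ and $\left\langle \frac{y_n^{(1)}-x_n}{\varepsilon}, \frac{y_n^{(2)}-x_n}{\varepsilon}\right\rangle \to -1$, where $\{y_n^{(1)},y_n^{(2)}\} = \Pi_E^{\mathrm{ext}}(x_n)$. *)

(* Defs.v *)
From HB Require Import structures.
From mathcomp Require Import all_boot all_order all_algebra.
From mathcomp Require Import all_classical all_reals all_analysis.

Set Implicit Arguments.
Unset Strict Implicit.
Unset Printing Implicit Defensive.

Import Order.TTheory GRing.Theory Num.Theory.
Import numFieldNormedType.Exports.

Local Open Scope classical_set_scope.
Local Open Scope ring_scope.

(* The plane is 'rV[R]_2.  The norm `|x| and the balls that MathComp-Analysis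
   puts on matrices come from the max-norm, so the Euclidean inner product,
   norm and balls are defined here.  The library topology on 'rV[R]_2 is the
   usual one, and it is used for closure, interior, compactness, connectedness
   and limits. *)

Definition dotv (R : realType) (x y : 'rV[R]_2) : R :=
  \sum_(i < 2) x 0 i * y 0 i.

Definition enorm (R : realType) (x : 'rV[R]_2) : R := Num.sqrt (dotv x x).

Definition eball (R : realType) (x : 'rV[R]_2) (r : R) : set 'rV[R]_2 :=
  [set z | enorm (z - x) < r].

Definition unit_circle (R : realType) : set 'rV[R]_2 := [set v | enorm v = 1].

Definition boundary (T : topologicalType) (A : set T) : set T :=
  closure A `\` interior A.

Definition nbhd (R : realType) (E : set 'rV[R]_2) (eps : R) : set 'rV[R]_2 :=
  closure (\bigcup_(p in E) eball p eps).

Definition half_ball (R : realType) (r : R) (x v : 'rV[R]_2) :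
    set 'rV[R]_2 :=
  [set z | eball x r z /\ 0 < dotv (z - x) v].

(* Contributors are considered only at points x of boundary (nbhd E eps). *)
Definition contributors (R : realType) (E : set 'rV[R]_2) (eps : R)
    (x : 'rV[R]_2) : set 'rV[R]_2 :=
  [set y | boundary E y /\ enorm (y - x) = eps].

Definition Unp (R : realType) (E : set 'rV[R]_2) (eps : R) : set 'rV[R]_2 :=
  [set x | boundary (nbhd E eps) x /\
           exists y, contributors E eps x = [set y]].

Definition smooth_point (R : realType) (E : set 'rV[R]_2) (eps : R)
    (x : 'rV[R]_2) : Prop :=
  boundary (nbhd E eps) x /\
  exists r : R, 0 < r /\
    boundary (nbhd E eps) `&` eball x r `<=` Unp E eps.

Definition singularities (R : realType) (E : set 'rV[R]_2) (eps : R) :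
    set 'rV[R]_2 :=
  [set x | boundary (nbhd E eps) x /\ ~ smooth_point E eps x].

Definition outward_directions (R : realType) (E : set 'rV[R]_2) (eps : R)
    (x : 'rV[R]_2) : set 'rV[R]_2 :=
  [set xi | unit_circle xi /\
     exists u : nat -> 'rV[R]_2,
       [/\ forall n, ~ nbhd E eps (u n),
           u @ \oo --> x &
           (fun n => (enorm (u n - x))^-1 *: (u n - x)) @ \oo --> xi]].

Definition extremal_directions (R : realType) (E : set 'rV[R]_2) (eps : R)
    (x : 'rV[R]_2) : set 'rV[R]_2 :=
  [set xi | outward_directions E eps x xi /\
     exists y, contributors E eps x y /\ dotv (y - x) xi = 0].

Definition extremal_contributors (R : realType) (E : set 'rV[R]_2) (eps : R)
    (x : 'rV[R]_2) : set 'rV[R]_2 :=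
  [set y | contributors E eps x y /\
     exists xi, outward_directions E eps x xi /\ dotv (y - x) xi = 0].

(* The pair {y1 n, y2 n} is the set of extremal contributors at u n, with
   y1 n = y2 n allowed; for such a pair, the two directions towards the
   contributors become opposite in the limit. *)
Definition opposite_contributors (R : realType) (E : set 'rV[R]_2) (eps : R)
    (u : nat -> 'rV[R]_2) : Prop :=
  exists y1 y2 : nat -> 'rV[R]_2,
    (forall n, extremal_contributors E eps (u n) = [set y1 n; y2 n]) /\
    (fun n => dotv (eps^-1 *: (y1 n - u n)) (eps^-1 *: (y2 n - u n)))
      @ \oo --> (-1 : R).

(* In the types below, quantifying existentially over xi1 and xi2 amounts to
   choosing a labelling of the one or two extremal outward directions. *)

Definition wedge (R : realType) (E : set 'rV[R]_2) (eps : R) :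
    set 'rV[R]_2 :=
  [set x | singularities E eps x /\
     exists xi1 xi2 : 'rV[R]_2,
       [/\ extremal_directions E eps x = [set xi1; xi2],
           xi1 <> xi2 & xi1 <> - xi2]].

Definition one_sided_sharp (R : realType) (E : set 'rV[R]_2) (eps : R) :
    set 'rV[R]_2 :=
  [set x | singularities E eps x /\
     exists xi1 xi2 : 'rV[R]_2,
       [/\ extremal_directions E eps x = [set xi1; xi2],
           xi1 = xi2 &
           exists delta : R, 0 < delta /\
             connected (eball x delta `\` nbhd E eps)]].

Definition sharp_sharp (R : realType) (E : set 'rV[R]_2) (eps : R) :
    set 'rV[R]_2 :=
  [set x | singularities E eps x /\
     exists xi1 xi2 : 'rV[R]_2,
       [/\ extremal_directions E eps x = [set xi1; xi2],
           ~ Unp E eps x,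
           xi1 = - xi2,
           exists delta1 : R, 0 < delta1 /\
             connected (half_ball delta1 x xi1 `\` nbhd E eps) &
           exists delta2 : R, 0 < delta2 /\
             connected (half_ball delta2 x xi2 `\` nbhd E eps)]].

Definition one_sided_shallow (R : realType) (E : set 'rV[R]_2) (eps : R) :
    set 'rV[R]_2 :=
  [set x | singularities E eps x /\
     exists xi1 xi2 : 'rV[R]_2,
       [/\ extremal_directions E eps x = [set xi1; xi2],
           Unp E eps x,
           exists delta1 : R, 0 < delta1 /\
             half_ball delta1 x xi1 `&` boundary (nbhd E eps)
               `<=` Unp E eps &
           forall delta2 : R, 0 < delta2 ->
             ~ (half_ball delta2 x xi2 `&` boundary (nbhd E eps)
                  `<=` Unp E eps)]].

Definition one_sided_chain (R : realType) (E : set 'rV[R]_2) (eps : R) :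
    set 'rV[R]_2 :=
  [set x | singularities E eps x /\
     exists xi1 xi2 : 'rV[R]_2,
       [/\ extremal_directions E eps x = [set xi1; xi2],
           xi1 = xi2 &
           exists u : nat -> 'rV[R]_2,
             [/\ forall n, singularities E eps (u n) /\ u n <> x,
                 u @ \oo --> x &
                 opposite_contributors E eps u]]].

Definition sharp_chain (R : realType) (E : set 'rV[R]_2) (eps : R) :
    set 'rV[R]_2 :=
  [set x | singularities E eps x /\
     exists xi1 xi2 : 'rV[R]_2,
       [/\ extremal_directions E eps x = [set xi1; xi2],
           xi1 = - xi2,
           exists delta1 : R, 0 < delta1 /\
             connected (half_ball delta1 x xi1 `\` nbhd E eps) &
           exists (delta2 : R) (u : nat -> 'rV[R]_2),
             [/\ 0 < delta2,
                 forall n, half_ball delta2 x xi2 (u n) /\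
                           singularities E eps (u n),
                 u @ \oo --> x &
                 opposite_contributors E eps u]]].

(* Main.v *)
Require Import Defs.
From mathcomp Require Import all_boot all_order all_algebra ring lra.
From mathcomp Require Import all_classical all_reals all_analysis.
Set Implicit Arguments.
Unset Strict Implicit.
Unset Printing Implicit Defensive.

Import Order.TTheory GRing.Theory Num.Theory.
Import numFieldNormedType.Exports.
Local Open Scope classical_set_scope.
Local Open Scope ring_scope.

(* Each class of singular points x is given by finitely many real parameters,
   unit vectors u with x + eps u a contributor ("feet" of x), a vector v
   orthogonal to u, and a scale d; two points of the class whose parameters are
   d-close must coincide, so each class is countable.

   If x and x' are on the boundary with close feet u, u', then neither point is
   inside the discs around the contributors of the other, so x' - x is nearly
   orthogonal to u.  With two independent feet at x this forces x' = x: this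
   covers the wedges.  Otherwise x' - x is nearly parallel to v, and one may
   assume that x' is in front of x with respect to both v and v'.
   - If xi1 = xi2 (types S2, S6), all points outside the offset near x' are in
     front of x', while x, which is behind x', is a limit of such points.
   - If only points with a unique contributor are found on the boundary in
     front of x (type S4), then x' is smooth.
   - If both u and - u are feet and a connected set outside the offset
     accumulates at x from the front (types S3, S8), this set lies between two
     tangent discs near x, and the segment [x' - eps u', x' + eps u'], which is
     contained in the offset, cuts it in two. *)

(** * Euclidean geometry of the plane in coordinates *)

Section EuclideanPlane.
Context {R : realType}.
Implicit Types (x y z u v w : 'rV[R]_2) (c r : R).

Lemma dotvE x y : dotv x y = x 0 0 * y 0 0 + x 0 1 * y 0 1.
Proof.
by rewrite /dotv !big_ord_recl big_ord0 addr0; congr (_ + x 0 _ * y 0 _);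
   apply/val_inj.
Qed.

Lemma rowv2_eq x y : x 0 0 = y 0 0 -> x 0 1 = y 0 1 -> x = y.
Proof.
move=> h0 h1; apply/rowP => -[[|[|//]] hi].
  by rewrite (_ : Ordinal hi = 0) //; apply/val_inj.
by rewrite (_ : Ordinal hi = 1) //; apply/val_inj.
Qed.

Lemma dotvC x y : dotv x y = dotv y x.
Proof. by rewrite !dotvE; ring. Qed.

Lemma dotvDl x y z : dotv (x + y) z = dotv x z + dotv y z.
Proof. by rewrite !dotvE !mxE; ring. Qed.

Lemma dotvNl x z : dotv (- x) z = - dotv x z.
Proof. by rewrite !dotvE !mxE; ring. Qed.

Lemma dotvZl c x z : dotv (c *: x) z = c * dotv x z.
Proof. by rewrite !dotvE !mxE; ring. Qed.

Lemma dotvDr x y z : dotv z (x + y) = dotv z x + dotv z y.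
Proof. by rewrite !dotvE !mxE; ring. Qed.

Lemma dotvNr x z : dotv z (- x) = - dotv z x.
Proof. by rewrite !dotvE !mxE; ring. Qed.

Lemma dotvZr c x z : dotv z (c *: x) = c * dotv z x.
Proof. by rewrite !dotvE !mxE; ring. Qed.

Definition dotv_lin := (dotvDl, dotvDr, dotvNl, dotvNr, dotvZl, dotvZr).

Lemma dotvv_ge0 x : 0 <= dotv x x.
Proof. by rewrite dotvE addr_ge0 // -expr2 sqr_ge0. Qed.

Lemma enorm_ge0 x : 0 <= enorm x.
Proof. exact: sqrtr_ge0. Qed.

Lemma sqr_enorm x : enorm x ^+ 2 = dotv x x.
Proof. by rewrite sqr_sqrtr // dotvv_ge0. Qed.

Lemma enorm_le_sqr x c : 0 <= c -> (enorm x <= c) = (dotv x x <= c ^+ 2).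
Proof. by move=> c0; rewrite -sqr_enorm ler_sqr ?nnegrE ?enorm_ge0. Qed.

Lemma enorm_lt_sqr x c : 0 <= c -> (enorm x < c) = (dotv x x < c ^+ 2).
Proof. by move=> c0; rewrite -sqr_enorm ltr_sqr ?nnegrE ?enorm_ge0. Qed.

Lemma enorm_ge_sqr x c : 0 <= c -> (c <= enorm x) = (c ^+ 2 <= dotv x x).
Proof. by move=> c0; rewrite -sqr_enorm ler_sqr ?nnegrE ?enorm_ge0. Qed.

Lemma enorm0 : enorm (0 : 'rV[R]_2) = 0.
Proof. by rewrite /enorm dotvE !mxE !mulr0 addr0 sqrtr0. Qed.

Lemma enorm_eq0 x : (enorm x == 0) = (x == 0).
Proof.
apply/eqP/eqP => [h|->]; last exact: enorm0.
have : dotv x x = 0 by rewrite -sqr_enorm h expr0n.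
rewrite dotvE => hx.
have [h0 h1] : x 0 0 = 0 /\ x 0 1 = 0 by split; nra.
by apply: rowv2_eq; rewrite mxE.
Qed.

Lemma enorm_gt0 x : (0 < enorm x) = (x != 0).
Proof. by rewrite lt_neqAle enorm_ge0 andbT eq_sym enorm_eq0. Qed.

Lemma enormN x : enorm (- x) = enorm x.
Proof. by rewrite /enorm !dotv_lin opprK. Qed.

Lemma enormBC x y : enorm (x - y) = enorm (y - x).
Proof. by rewrite -enormN opprB. Qed.

Lemma enormZ c x : enorm (c *: x) = `|c| * enorm x.
Proof.
by rewrite /enorm !dotv_lin mulrA -expr2 sqrtrM ?sqr_ge0 // sqrtr_sqr.
Qed.

Lemma cauchy_schwarz x y : `|dotv x y| <= enorm x * enorm y.
Proof.
rewrite -ler_sqr ?nnegrE ?mulr_ge0 ?enorm_ge0 // real_normK ?num_real //.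
rewrite exprMn !sqr_enorm !dotvE.
(* Lagrange's identity: the two sides differ by the square of this determinant. *)
have := sqr_ge0 (x 0 0 * y 0 1 - x 0 1 * y 0 0); lra.
Qed.

Lemma dotv_le x y : dotv x y <= enorm x * enorm y.
Proof. exact: le_trans (ler_norm _) (cauchy_schwarz x y). Qed.

Lemma ler_enormD x y : enorm (x + y) <= enorm x + enorm y.
Proof.
rewrite enorm_le_sqr ?addr_ge0 ?enorm_ge0 // sqrrD !sqr_enorm !dotv_lin.
by have := dotv_le x y; rewrite (dotvC y x); lra.
Qed.

Lemma enorm_triangle y x z : enorm (x - z) <= enorm (x - y) + enorm (y - z).
Proof. by apply: le_trans (ler_enormD _ _); rewrite addrA subrK. Qed.

Lemma coord_le_enorm x i : `|x 0 i| <= enorm x.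
Proof.
rewrite -ler_sqr ?nnegrE ?enorm_ge0 // real_normK ?num_real //.
rewrite sqr_enorm dotvE.
case: i => -[|[|//]] hi.
  rewrite (_ : Ordinal hi = 0); last exact/val_inj.
  have := sqr_ge0 (x 0 1); lra.
rewrite (_ : Ordinal hi = 1); last exact/val_inj.
have := sqr_ge0 (x 0 0); lra.
Qed.

Lemma enorm_le_coord x : enorm x <= `|x 0 0| + `|x 0 1|.
Proof.
rewrite enorm_le_sqr ?addr_ge0 // dotvE.
have := normr_ge0 (x 0 0); have := normr_ge0 (x 0 1).
rewrite -!expr2 -(real_normK (num_real (x 0 0))).
rewrite -(real_normK (num_real (x 0 1))).
nra.
Qed.

(** * Orthonormal frames *)

Definition frame u v := [/\ enorm u = 1, enorm v = 1 & dotv u v = 0].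

Lemma unitP u : enorm u = 1 -> dotv u u = 1.
Proof. by rewrite -sqr_enorm => ->; rewrite expr1n. Qed.

Lemma frame_decomp u v w : frame u v -> w = dotv w u *: u + dotv w v *: v.
Proof.
move=> [/unitP + /unitP]; rewrite !dotvE => hu hv huv.
set d := u 0 0 * v 0 1 - u 0 1 * v 0 0.
have d2 : d ^+ 2 = 1.
  transitivity ((u 0 0 * u 0 0 + u 0 1 * u 0 1) *
                (v 0 0 * v 0 0 + v 0 1 * v 0 1) -
                (u 0 0 * v 0 0 + u 0 1 * v 0 1) ^+ 2); first by rewrite /d; ring.
  by rewrite hu hv huv; ring.
(* The determinant [d] is a sign, and [v] is [d] times [u] turned by a right angle. *)
have a : v 0 0 = - d * u 0 1.
  transitivity (v 0 0 * (u 0 0 * u 0 0 + u 0 1 * u 0 1)).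
    by rewrite hu mulr1.
  transitivity (u 0 0 * (u 0 0 * v 0 0 + u 0 1 * v 0 1) - d * u 0 1).
    by rewrite /d; ring.
  by rewrite huv; ring.
have b : v 0 1 = d * u 0 0.
  transitivity (v 0 1 * (u 0 0 * u 0 0 + u 0 1 * u 0 1)).
    by rewrite hu mulr1.
  transitivity (u 0 1 * (u 0 0 * v 0 0 + u 0 1 * v 0 1) + d * u 0 0).
    by rewrite /d; ring.
  by rewrite huv; ring.
clearbody d; apply: rowv2_eq; rewrite !mxE a b.
- transitivity (w 0 0 * (u 0 0 * u 0 0 + d ^+ 2 * (u 0 1 * u 0 1)) +
                w 0 1 * (u 0 0 * u 0 1 - d ^+ 2 * (u 0 0 * u 0 1))); last by ring.
  by rewrite d2 !mul1r hu subrr; ring.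
- transitivity (w 0 1 * (u 0 1 * u 0 1 + d ^+ 2 * (u 0 0 * u 0 0)) +
                w 0 0 * (u 0 0 * u 0 1 - d ^+ 2 * (u 0 0 * u 0 1))); last by ring.
  by rewrite d2 !mul1r subrr (addrC (u 0 1 * u 0 1)) hu; ring.
Qed.

Lemma frame_sqr_enorm u v w : frame u v ->
  dotv w w = dotv w u ^+ 2 + dotv w v ^+ 2.
Proof.
by move=> uv; rewrite {2}(frame_decomp w uv) !dotv_lin !expr2.
Qed.

Lemma frame_parallel u v w : frame u v -> enorm w = 1 -> dotv w v = 0 ->
  w = u \/ w = - u.
Proof.
move=> uv /unitP w1 wv.
have := frame_decomp w uv; rewrite wv scale0r addr0 => e.
have : dotv w u ^+ 2 = 1 by rewrite -w1 (frame_sqr_enorm w uv) wv expr0n addr0.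
by move=> /eqP; rewrite sqrf_eq1 => /orP[] /eqP h; rewrite e h ?scale1r ?scaleN1r; [left|right].
Qed.

Lemma frameC u v : frame u v -> frame v u.
Proof. by move=> [? ? ?]; split=> //; rewrite dotvC. Qed.

Lemma frameNl u v : frame u v -> frame (- u) v.
Proof. by move=> [? ? h]; split=> //; rewrite ?enormN // dotvNl h oppr0. Qed.

Lemma frameNr u v : frame u v -> frame u (- v).
Proof. by move=> /frameC/frameNl/frameC. Qed.

Lemma frame_exists u : enorm u = 1 -> exists v, frame u v.
Proof.
move=> u1; exists (\row_j if j == 0 then - u 0 1 else u 0 0); split => //.
  by rewrite -u1 /enorm !dotvE !mxE /=; congr Num.sqrt; ring.
by rewrite !dotvE !mxE /=; ring.
Qed.

(** * The Euclidean norm and the topology of the plane *)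

Let continuous_sum_of_prods {T : topologicalType} (a b c d : T -> R) :
  continuous a -> continuous b -> continuous c -> continuous d ->
  continuous (fun t => a t * b t + c t * d t).
Proof.
move=> ca cb cc cd z.
by apply: cvgD; apply: cvgM; [exact: ca|exact: cb|exact: cc|exact: cd].
Qed.

Let continuous_shift {T : topologicalType} (a : T -> R) c :
  continuous a -> continuous (fun t => a t - c).
Proof. by move=> ca z; apply: cvgB; [exact: ca|exact: cvg_cst]. Qed.

Let coord_shift_continuous x i :
  continuous (fun z : 'rV[R]_2 => z 0 i - x 0 i).
Proof. by apply: continuous_shift => z; exact: coord_continuous. Qed.

Lemma enorm_continuous x : continuous (fun z : 'rV[R]_2 => enorm (z - x)).
Proof.
have cd : continuous (fun w : 'rV[R]_2 => dotv (w - x) (w - x)).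
  under eq_fun do rewrite dotvE !mxE.
  by apply: continuous_sum_of_prods; exact: coord_shift_continuous.
move=> z; apply: (@continuous_comp _ _ _ (fun w => dotv (w - x) (w - x))
                                   (@Num.sqrt R)).
  exact: cd.
exact: sqrt_continuous.
Qed.

Lemma dotv_continuous x v : continuous (fun z : 'rV[R]_2 => dotv (z - x) v).
Proof.
under eq_fun do rewrite dotvE !mxE.
have ccst c : continuous (fun _ : 'rV[R]_2 => c) by exact: cst_continuous.
exact: (continuous_sum_of_prods (@coord_shift_continuous x 0) (@ccst _)
                                (@coord_shift_continuous x 1) (@ccst _)).
Qed.

Lemma open_lt_fun {T : topologicalType} (f : T -> R) c :
  continuous f -> open [set t | f t < c].
Proof.
by move=> /continuousP cf; apply: (cf [set t | t < c]); exact: open_lt.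
Qed.

Lemma open_gt_fun {T : topologicalType} (f : T -> R) c :
  continuous f -> open [set t | c < f t].
Proof.
by move=> /continuousP cf; apply: (cf [set t | c < t]); exact: open_gt.
Qed.

Lemma closed_le_fun {T : topologicalType} (f : T -> R) c :
  continuous f -> closed [set t | f t <= c].
Proof.
by move=> /continuous_closedP cf; apply: (cf [set t | t <= c]); exact: closed_le.
Qed.

Lemma closed_ge_fun {T : topologicalType} (f : T -> R) c :
  continuous f -> closed [set t | c <= f t].
Proof.
by move=> /continuous_closedP cf; apply: (cf [set t | c <= t]); exact: closed_ge.
Qed.

(** Coordinates are bounded by [enorm], so a Euclidean ball lies in the max-norm ball of the same
    radius; it is open by continuity of [enorm]. This turns topological statements into Euclidean
    estimates. *)
Lemma nbhs_enorm x (A : set 'rV[R]_2) :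
  nbhs x A <-> exists2 r : R, 0 < r & eball x r `<=` A.
Proof.
split.
  move=> /nbhs_ballP[r /= r0 h]; exists r => // z zr; apply: h => /=.
  split => // i j; rewrite ord1 /ball /=; apply: le_lt_trans zr.
  by have := coord_le_enorm (x - z) j; rewrite !mxE -enormBC.
move=> [r r0 h]; apply: (@filterS _ _ _ (eball x r)) => //.
apply: open_nbhs_nbhs; split; last by rewrite /eball /= subrr enorm0.
by apply: open_lt_fun; exact: enorm_continuous.
Qed.

End EuclideanPlane.

(** * Countability by local separation *)

(** Lowering [d0] to some [mesh n] and replacing [x], [u], [v] by their cells in a square grid
    encodes a point of [A] by integers. Points with the same code are close in all three parameters
    at a common scale, hence equal. *)
Lemma countable_of_local_separation {R : realType} (A : set 'rV[R]_2)
    (P : R -> 'rV[R]_2 -> 'rV[R]_2 -> 'rV[R]_2 -> Prop) :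
  (forall x, A x -> exists u v d0, 0 < d0 /\
     forall d, 0 < d -> d <= d0 -> P d x u v) ->
  (forall d x u v x' u' v', 0 < d -> P d x u v -> P d x' u' v' ->
     enorm (x' - x) < d -> enorm (u' - u) < d -> enorm (v' - v) < d ->
     x = x') ->
  countable A.
Proof.
move=> exP sepP.
(* Cells have side [1 / n.+1]; the factor 2 passes from the two coordinates to [enorm]. *)
pose mesh (n : nat) : R := 2 / n.+1%:R.
pose cell n (x : 'rV[R]_2) :=
  (Num.floor (n.+1%:R * x 0 0), Num.floor (n.+1%:R * x 0 1)).
have floor_close (a b : R) : Num.floor a = Num.floor b -> `|a - b| < 1.
  move=> ab; have := floor_itv a; have := floor_itv b; rewrite ab !intrD.
  by rewrite ltr_norml => /andP[? ?] /andP[? ?]; apply/andP; split; lra.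
have cell_close n (x y : 'rV[R]_2) : cell n x = cell n y ->
    enorm (y - x) < mesh n.
  move=> [/floor_close h0 /floor_close h1].
  apply: le_lt_trans (enorm_le_coord _) _; rewrite !mxE.
  rewrite distrC (distrC (y 0 1)) /mesh.
  have n0 : 0 < n.+1%:R :> R by rewrite ltr0n.
  rewrite -mulrBr normrM gtr0_norm // in h0.
  rewrite -mulrBr normrM gtr0_norm // in h1.
  rewrite ltr_pdivlMr // mulrDl -!(mulrC n.+1%:R); lra.
have {exP} exP x : exists t : 'rV[R]_2 * 'rV[R]_2 * nat,
    A x -> P (mesh t.2) x t.1.1 t.1.2.
  have [/exP[u [v [d0 [d00 h]]]]|] := pselect (A x); last by exists (0, 0, 0%N).
  exists (u, v, Num.truncn (2 / d0)) => _ /=.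
  have m0 : 0 < mesh (Num.truncn (2 / d0)) by rewrite divr_gt0 ?ltr0n.
  apply: h => //; rewrite ler_pdivrMr ?ltr0n // mulrC -ler_pdivrMr //.
  by rewrite ltW // truncnS_gt.
have {exP} [f fP] := choice exP.
pose code x := ((f x).2, cell (f x).2 x, cell (f x).2 (f x).1.1,
                cell (f x).2 (f x).1.2).
apply/countable_injP; exists (pickle \o code) => x y /set_mem Ax /set_mem Ay.
move=> /= /(pcan_inj pickleK)[enx].
have := fP x Ax; have := fP y Ay; rewrite -enx => Py Px.
move=> e1 e2 f1 f2 g1 g2.
by apply: (sepP _ _ _ _ _ _ _ _ Px Py); rewrite ?divr_gt0 ?ltr0n //;
   apply: cell_close; congr pair.
Qed.

Lemma small_factor {R : realFieldType} (r c : R) : 0 < r -> 0 <= c ->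
  exists t, [/\ 0 < t, t < 1 & t * c < r].
Proof.
move=> r0 c0; have s0 : 0 < 2 * (r + c) by lra.
exists (r / (2 * (r + c))); split; first exact: divr_gt0.
  by rewrite ltr_pdivrMr //; lra.
by rewrite mulrAC ltr_pdivrMr //; nra.
Qed.

(** * The offset of a compact set *)

Section Offset.
Context {R : realType} (E : set 'rV[R]_2) (eps : R).
Hypotheses (E_compact : compact E) (eps_gt0 : 0 < eps).
Implicit Types (x y z u v w : 'rV[R]_2).

Let E_closed : closed E.
Proof. by apply: compact_closed => //; exact: norm_hausdorff. Qed.

Lemma compact_nearest (K : set 'rV[R]_2) x : compact K -> K !=set0 ->
  exists2 y, K y & forall y', K y' -> enorm (y - x) <= enorm (y' - x).
Proof.
move=> cK K0.
have [|y /set_mem Ky h] := EVT_min_rV K0 cK (f := fun z => enorm (z - x)).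
  by apply: continuous_subspaceT; exact: enorm_continuous.
by exists y => // y' Ky'; apply: h; rewrite inE.
Qed.

(** The distance to the compact set [E] is attained, so approximation by the open balls yields the
    closed bound. Conversely, moving [z] slightly towards [y] enters the open ball. *)
Lemma nbhdP z : nbhd E eps z <-> exists2 y, E y & enorm (y - z) <= eps.
Proof.
split=> [cz|[y Ey yz]].
- have near r : 0 < r -> exists2 y, E y & enorm (y - z) < eps + r.
    move=> r0.
    have /cz[z' [[y Ey yz'] zz']] : nbhs z (eball z r).
      by apply/nbhs_enorm; exists r.
    exists y => //; apply: le_lt_trans (enorm_triangle z' _ _) _.
    by rewrite ltrD // enormBC.
  have [y0 Ey0 _] := near 1 ltr01.
  have [y Ey ymin] := compact_nearest z E_compact (ex_intro _ y0 Ey0).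
  exists y => //; rewrite leNgt; apply/negP => lt_eps.
  have [|y' Ey' y'z] := near (enorm (y - z) - eps); first by rewrite subr_gt0.
  by move: y'z (ymin _ Ey'); lra.
- move=> B /nbhs_enorm[r r0 rB].
  have n0 := enorm_ge0 (z - y).
  have [t [t0 t1 tr]] := small_factor r0 n0.
  exists (z - t *: (z - y)); split.
    exists y => //; rewrite /eball /=.
    have -> : z - t *: (z - y) - y = (1 - t) *: (z - y).
      by apply/rowP => i; rewrite !mxE; ring.
    rewrite enormZ ger0_norm ?subr_ge0 ?ltW //; move: yz; rewrite enormBC => zy.
    have [->|] := eqVneq (enorm (z - y)) 0; first by rewrite mulr0.
    by rewrite neq_lt ltNge n0 /= => np; nra.
  by apply: rB; rewrite /eball /= addrC addKr enormN enormZ gtr0_norm.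
Qed.

Definition outside z := ~ nbhd E eps z.

Lemma outside_lt z y : outside z -> E y -> eps < enorm (y - z).
Proof. by move=> Wz Ey; rewrite ltNge; apply/negP => ?; apply/Wz/nbhdP; exists y. Qed.

Definition far x := forall y, E y -> eps <= enorm (y - x).

Lemma boundary_far x : boundary (nbhd E eps) x -> far x.
Proof.
move=> [_ nint] y Ey; rewrite leNgt; apply/negP => yx; apply: nint.
apply/nbhs_enorm; exists (eps - enorm (y - x)); first by rewrite subr_gt0.
move=> z zx; apply/nbhdP; exists y => //.
apply: le_trans (enorm_triangle x _ _) _.
by move: zx; rewrite /eball /= (enormBC z); lra.
Qed.

Lemma boundary_outside x r : boundary (nbhd E eps) x -> 0 < r ->
  exists2 z, outside z & enorm (z - x) < r.
Proof.
move=> [_ nint] r0; apply: contrapT => h; apply: nint.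
apply/nbhs_enorm; exists r => // z zx; apply: contrapT => Wz.
by apply: h; exists z.
Qed.

(** If [y] were interior to [E], a point of [E] slightly nearer to [x] would contradict
    [boundary_far]. Hence feet can be described by [E] alone. *)
Lemma contributorsP x y : boundary (nbhd E eps) x ->
  contributors E eps x y <-> E y /\ enorm (y - x) = eps.
Proof.
move=> bx; split=> [[[cy _] ?]|[Ey yx]]; split=> //; first exact: E_closed.
split; first exact: subset_closure.
move=> /nbhs_enorm[r r0 rE].
have [t [t0 t1 tr]] := small_factor r0 (ltW eps_gt0).
have /rE/(boundary_far bx) : eball y r (y - t *: (y - x)).
  by rewrite /eball /= addrC addKr enormN enormZ gtr0_norm // yx.
have -> : y - t *: (y - x) - x = (1 - t) *: (y - x).
  by apply/rowP => i; rewrite !mxE; ring.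
by rewrite enormZ yx gtr0_norm ?subr_gt0 //; have := mulr_gt0 t0 eps_gt0; lra.
Qed.

Definition foot x u := enorm u = 1 /\ E (x + eps *: u).

Lemma foot_contributor x u : boundary (nbhd E eps) x -> foot x u ->
  contributors E eps x (x + eps *: u).
Proof.
move=> bx [u1 Eu]; apply/contributorsP => //; split=> //.
by rewrite addrAC subrr add0r enormZ u1 mulr1 gtr0_norm.
Qed.

Lemma contributor_foot x y : boundary (nbhd E eps) x ->
  contributors E eps x y -> exists2 u, foot x u & y = x + eps *: u.
Proof.
move=> bx /(contributorsP _ bx)[Ey yx].
have e0 : eps != 0 by rewrite gt_eqF.
have e : y = x + eps *: (eps^-1 *: (y - x)).
  by rewrite scalerA divff // scale1r addrC subrK.
exists (eps^-1 *: (y - x)) => //; split; last by rewrite -e.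
by rewrite enormZ yx gtr0_norm ?invr_gt0 // mulVf.
Qed.

(** Squaring the hypothesis gives the claim: avoiding the open disc around the contributor makes the
    component of [z - x] towards it at most quadratic in [z - x]. *)
Lemma foot_ineq x u z : enorm u = 1 -> eps <= enorm (x + eps *: u - z) ->
  2 * eps * dotv (z - x) u <= dotv (z - x) (z - x).
Proof.
move=> /unitP u1.
have -> : x + eps *: u - z = eps *: u - (z - x).
  by apply/rowP => i; rewrite !mxE; ring.
by move: (z - x) => w; rewrite (enorm_ge_sqr _ (ltW eps_gt0)) !dotv_lin (dotvC u w) u1; lra.
Qed.

End Offset.

Lemma frame_enorm_le {R : realType} (u v w : 'rV[R]_2) : frame u v ->
  enorm w <= `|dotv w u| + `|dotv w v|.
Proof.
move=> uv; have [u1 v1 _] := uv; rewrite {1}(frame_decomp w uv).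
by apply: le_trans (ler_enormD _ _) _; rewrite !enormZ u1 v1 !mulr1.
Qed.

Lemma dotv_unit_le {R : realType} (u w : 'rV[R]_2) : enorm u = 1 ->
  `|dotv w u| <= enorm w.
Proof. by move=> u1; have := cauchy_schwarz w u; rewrite u1 mulr1. Qed.

(** * Countable classes of boundary points *)

Section Counting.
Context {R : realType} (E : set 'rV[R]_2) (eps : R).
Hypotheses (E_compact : compact E) (eps_gt0 : 0 < eps).
Implicit Types (x y z u v w : 'rV[R]_2) (d : R).

Local Notation foot := (foot E eps).
Local Notation far := (far E eps).
Local Notation outside := (outside E eps).
Local Notation bdry := (boundary (nbhd E eps)).

(** For [w = x' - x], [foot_ineq] at [x] bounds [dotv w u] above and [foot_ineq] at [x'] bounds
    [dotv w u'] below, both by multiples of [enorm w ^+ 2]. Exchanging [u'] for [u] costs at most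
    [d * enorm w]. *)
Lemma normal_component d x u x' u' :
  far x -> far x' -> foot x u -> foot x' u' ->
  enorm (x' - x) < d -> enorm (u' - u) < d ->
  2 * eps * `|dotv (x' - x) u| <= (1 + 2 * eps) * d * enorm (x' - x).
Proof.
move=> fx fx' [u1 Eu] [u1' Eu'] wd ud.
have i1 := foot_ineq eps_gt0 u1 (fx' _ Eu).
have i2 := foot_ineq eps_gt0 u1' (fx _ Eu').
rewrite -opprB in i2; move: i1 i2 wd; move: (x' - x) => w i1 i2 wd.
rewrite -!sqr_enorm enormN dotvNl in i1 i2.
have n0 := enorm_ge0 w.
have wu : `|dotv w (u' - u)| <= d * enorm w.
  by apply: le_trans (cauchy_schwarz _ _) _; rewrite mulrC ler_wpM2r // ltW.
have ww : enorm w ^+ 2 <= d * enorm w by rewrite expr2 ler_wpM2r // ltW.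
rewrite dotvDr dotvNr ler_norml in wu; case/andP: wu => wu1 wu2.
have wu1' : 2 * eps * - (d * enorm w) <= 2 * eps * (dotv w u' - dotv w u).
  by rewrite ler_wpM2l // mulr_ge0 // ltW.
have wu2' : 2 * eps * (dotv w u' - dotv w u) <= 2 * eps * (d * enorm w).
  by rewrite ler_wpM2l // mulr_ge0 // ltW.
have [s|s] := leP 0 (dotv w u).
  rewrite ger0_norm //.
  have : 0 <= eps * (d * enorm w) by rewrite !mulr_ge0 // ltW // (le_lt_trans n0 wd).
  move=> h; apply: (le_trans i1); apply: (le_trans ww); lra.
rewrite ltr0_norm //; lra.
Qed.

(** * Points with two linearly independent feet *)

Definition corners : set 'rV[R]_2 := [set x | bdry x /\
  exists u u', [/\ foot x u, foot x u', u' <> u & u' <> - u]].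

Lemma countable_corners : countable corners.
Proof.
(* The 3 counts uses of [normal_component]: for [w = x' - x], [enorm w] times [dotv u' v] is bounded
   by twice the component along [u] plus the one along [u']. *)
pose P d x u u' := [/\ far x, foot x u, foot x u' &
  exists2 v, frame u v & 3 * (1 + 2 * eps) * d < 2 * eps * `|dotv u' v|].
apply: (@countable_of_local_separation _ _ P) => [x [bx [u [u' [fu fu' n1 n2]]]]|].
  have [v uv] := frame_exists (proj1 fu).
  have c0 : 0 < `|dotv u' v|.
    rewrite normr_gt0; apply/eqP => h.
    by case: (frame_parallel uv (proj1 fu') h).
  exists u, u', (eps * `|dotv u' v| / (3 * (1 + 2 * eps))).
  have e0 := eps_gt0.
  have k0 : 0 < 3 * (1 + 2 * eps) by lra.
  split; first by rewrite divr_gt0 // mulr_gt0.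
  move=> d d0; rewrite ler_pdivlMr // => dle; split=> //.
    exact: boundary_far.
  exists v => //; have := mulr_gt0 eps_gt0 c0; lra.
move=> d x u u' x' v v' d0 [fx fu fu' [n un dc]] [fx' fv fv' _] wd uvd uvd'.
apply/esym/eqP; rewrite -subr_eq0 -enorm_eq0 -[_ == 0]negbK; apply/negP => w0.
have i1 := normal_component fx fx' fu fv wd uvd.
have i2 := normal_component fx fx' fu' fv' wd uvd'.
move: w0 i1 i2 {wd}; move: (x' - x) => w w0 i1 i2.
have n0 : 0 < enorm w by rewrite lt_neqAle eq_sym w0 enorm_ge0.
have i3 := frame_enorm_le w un.
have c1 : `|dotv u' n| <= 1.
  by have [_ n1 _] := un; rewrite -(proj1 fu') dotv_unit_le.
have i4 : `|dotv w n| * `|dotv u' n| <= `|dotv w u'| + `|dotv w u|.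
  rewrite -normrM (_ : dotv w n * _ = dotv w u' - dotv w u * dotv u u').
    apply: le_trans (ler_normB _ _) _; rewrite lerD2l normrM ler_piMr //.
    by have := dotv_unit_le u (proj1 fu'); rewrite (proj1 fu).
  by rewrite {2}(frame_decomp w un) !dotv_lin (dotvC n); ring.
have i5 : enorm w * `|dotv u' n| <=
    `|dotv w u| * `|dotv u' n| + (`|dotv w u'| + `|dotv w u|).
  by apply: le_trans (ler_wpM2r _ i3) _; rewrite // mulrDl lerD2l.
have i6 : `|dotv w u| * `|dotv u' n| <= `|dotv w u| by rewrite ler_piMr.
have : enorm w * (2 * eps * `|dotv u' n|) <= 3 * (1 + 2 * eps) * d * enorm w.
  have : 2 * eps * (enorm w * `|dotv u' n|) <=
      2 * eps * (`|dotv w u| + (`|dotv w u'| + `|dotv w u|)).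
    by apply: ler_wpM2l; [rewrite mulr_ge0 // ltW|lra].
  lra.
by rewrite mulrC ler_pM2r // leNgt dc.
Qed.

(** * Points with aligned feet *)

Definition placed x u v := [/\ far x, foot x u & frame u v].

(** For [w = x' - x], the bound on [d] gives at most [enorm w / 8] for the component along [u], and
    [d <= 1 / 16]. So the component along [v] dominates, and that along [v'] has the same sign; if
    it is negative, [x] and [x'] are swapped. *)
Lemma countable_aligned (A : set 'rV[R]_2)
    (Q : R -> 'rV[R]_2 -> 'rV[R]_2 -> 'rV[R]_2 -> Prop) :
  (forall x, A x -> exists u v d0, [/\ placed x u v, 0 < d0 &
     forall d, 0 < d -> d <= d0 -> Q d x u v]) ->
  (forall d x u v x' u' v', 0 < d -> (1 + 2 * eps) * d <= eps / 8 ->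
     placed x u v -> placed x' u' v' -> Q d x u v -> Q d x' u' v' ->
     enorm (x' - x) < d -> enorm (u' - u) < d -> enorm (v' - v) < d ->
     0 < dotv (x' - x) v -> 0 < dotv (x' - x) v' -> False) ->
  countable A.
Proof.
move=> exQ sepQ.
pose P d x u v := [/\ (1 + 2 * eps) * d <= eps / 8, placed x u v & Q d x u v].
apply: (@countable_of_local_separation _ _ P) => [x /exQ[u [v [d0 [pl d00 h]]]]|].
  have k0 : 0 < 1 + 2 * eps by rewrite ltr_wpDr // mulr_ge0 // ltW.
  exists u, v, (Num.min d0 (eps / 8 / (1 + 2 * eps))); split.
    by rewrite lt_min d00 !divr_gt0.
  move=> d dpos; rewrite le_min => /andP[dd0]; rewrite ler_pdivlMr // => de.
  by split=> //; [rewrite mulrC|exact: h].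
move=> d x u v x' u' v' d0 [de pl Qx] [_ pl' Qx'] wd ud vd.
apply/esym/eqP; rewrite -subr_eq0 -enorm_eq0 -[_ == 0]negbK; apply/negP => w0.
have [[fx fu uv] [fx' fu' uv']] := (pl, pl').
have i1 := normal_component fx fx' fu fu' wd ud.
have n0 : 0 < enorm (x' - x) by rewrite lt_neqAle eq_sym w0 enorm_ge0.
have i2 : 8 * `|dotv (x' - x) u| <= enorm (x' - x).
  have : (1 + 2 * eps) * d * enorm (x' - x) <= eps / 8 * enorm (x' - x).
    by rewrite ler_wpM2r // ltW.
  move=> h; rewrite -(ler_pM2l eps_gt0).
  have := mulr_gt0 eps_gt0 n0; lra.
have i3 := frame_enorm_le (x' - x) uv.
have d16 : d <= 1 / 16.
  rewrite -(ler_pM2l eps_gt0); lra.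
have i4 : `|dotv (x' - x) (v' - v)| <= enorm (x' - x) / 16.
  apply: le_trans (cauchy_schwarz _ _) _; rewrite ler_wpM2l ?enorm_ge0 //; lra.
have [s|s] := leP 0 (dotv (x' - x) v).
  rewrite (ger0_norm s) in i3.
  apply: (sepQ d x u v x' u' v') => //; first lra.
  by move: i4; rewrite dotvDr dotvNr ler_norml => /andP[]; lra.
rewrite (ltr0_norm s) in i3.
apply: (sepQ d x' u' v' x u v); rewrite // 1?enormBC // -opprB dotvNl.
  by move: i4; rewrite dotvDr dotvNr ler_norml => /andP[]; lra.
by rewrite oppr_gt0.
Qed.

Definition one_sided : set 'rV[R]_2 := [set x | bdry x /\
  exists u v d0, [/\ foot x u, frame u v, 0 < d0 &
    forall z, outside z -> enorm (z - x) < d0 -> 0 <= dotv (z - x) v]].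

Lemma countable_one_sided : countable one_sided.
Proof.
pose Q d x (u v : 'rV[R]_2) := bdry x /\
  forall z, outside z -> enorm (z - x) < d -> 0 <= dotv (z - x) v.
apply: (@countable_aligned _ Q) => [x [bx [u [v [d0 [fu uv d00 h]]]]]|].
  exists u, v, d0; split=> //; first by split=> //; exact: boundary_far.
  by move=> d _ dd0; split=> // z Wz zx; apply: h => //; exact: lt_le_trans dd0.
move=> d x u v x' u' v' d0 _ _ [_ _ [_ v1' _]] [bx _] [_ h] wd _ _ _ wv'.
(* The first bound keeps [z], like [x], strictly behind [x'] with respect to [v']; the second keeps
   it within [d] of [x']. *)
have [z Wz zx] : exists2 z, outside z &
    enorm (z - x) < Num.min (dotv (x' - x) v') (d - enorm (x' - x)).
  by apply: boundary_outside; rewrite // lt_min wv' subr_gt0.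
move: zx; rewrite lt_min => /andP[zx1 zx2].
have := h z Wz; rewrite leNgt; case/(_ _)/negP.
  apply: le_lt_trans (enorm_triangle x _ _) _; rewrite (enormBC x); lra.
rewrite (_ : z - x' = (z - x) - (x' - x)); last by rewrite opprB addrA subrK.
rewrite dotvDl dotvNl subr_lt0; apply: le_lt_trans zx1.
exact: le_trans (ler_norm _) (dotv_unit_le _ v1').
Qed.

Lemma open_half_ball d x v : open (half_ball d x v).
Proof.
apply: openI; first by apply: open_lt_fun; exact: enorm_continuous.
by apply: open_gt_fun; exact: dotv_continuous.
Qed.

Definition shallow : set 'rV[R]_2 := [set x | singularities E eps x /\
  exists u v d0, [/\ foot x u, frame u v, 0 < d0 &
    half_ball d0 x v `&` bdry `<=` Unp E eps]].

Lemma countable_shallow : countable shallow.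
Proof.
pose Q d x (u v : 'rV[R]_2) := singularities E eps x /\
  half_ball d x v `&` bdry `<=` Unp E eps.
apply: (@countable_aligned _ Q) => [x [sx [u [v [d0 [fu uv d00 h]]]]]|].
  exists u, v, d0; split=> //.
    by split=> //; apply: boundary_far => //; case: sx.
  move=> d _ dd0; split=> // z [[zx zv] bz]; apply: h; split=> //; split=> //.
  exact: lt_le_trans dd0.
move=> d x u v x' u' v' d0 _ _ _ [_ h] [[bx' ns] _] wd _ _ wv _.
apply: ns; split=> //.
have /nbhs_enorm[r r0 hr] : nbhs x' (half_ball d x v).
  by apply: open_nbhs_nbhs; split; [exact: open_half_ball|split].
by exists r; split=> // z [bz zx]; apply: h; split=> //; exact: hr.
Qed.

(** Common form of the sharp-sharp and sharp-chain types, with [U] the part of a half disc that lies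
    outside the offset. *)
Definition cusps : set 'rV[R]_2 := [set x | bdry x /\
  exists u v (U : set 'rV[R]_2),
    [/\ foot x u, foot x (- u) & frame u v] /\
    [/\ connected U, U `<=` outside &
        forall r : R, 0 < r ->
          exists z, [/\ U z, enorm (z - x) < r & 0 < dotv (z - x) v]]].

(** This is [foot_ineq] for [u] and [- u] at once, strict because [z] avoids the closed discs. *)
Lemma between_feet x u v z : frame u v -> foot x u -> foot x (- u) ->
  outside z ->
  2 * eps * `|dotv (z - x) u| < dotv (z - x) v ^+ 2 + dotv (z - x) u ^+ 2.
Proof.
move=> uv [u1 E1] [_ E2] Wz.
have := outside_lt E_compact eps_gt0 Wz E1; have := outside_lt E_compact eps_gt0 Wz E2.
have -> : x + eps *: u - z = eps *: u - (z - x).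
  by apply/rowP => i; rewrite !mxE; ring.
have -> : x + eps *: - u - z = eps *: - u - (z - x).
  by apply/rowP => i; rewrite !mxE; ring.
move: (z - x) => w; rewrite !ltNge !enorm_le_sqr ?(ltW eps_gt0) // -!ltNge.
rewrite [_ + dotv w u ^+ 2]addrC -(frame_sqr_enorm w uv).
rewrite !dotv_lin (unitP u1) (dotvC u w) => h1 h2.
have [s|s] := leP 0 (dotv w u); [rewrite ger0_norm //|rewrite ltr0_norm //]; lra.
Qed.

Lemma countable_cusps : countable cusps.
Proof.
(* The witness [p] must end up in front of [x'] with respect to [v']: [x'] has height below [d] over
   [x], and tilting [v] to [v'] costs at most [eps * d], hence [(1 + eps) * d]. *)
pose Q d x u v := foot x (- u) /\ exists U : set 'rV[R]_2,
  [/\ connected U, U `<=` outside,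
      forall r : R, 0 < r ->
        exists z, [/\ U z, enorm (z - x) < r & 0 < dotv (z - x) v] &
      exists p, [/\ U p, enorm (p - x) <= eps &
                    (1 + eps) * d <= dotv (p - x) v]].
have e1 : 0 < 1 + eps by rewrite ltr_wpDr // ltW.
apply: (@countable_aligned _ Q) =>
    [x [bx [u [v [U [[fu fu' uv] [cU UW Ux]]]]]]|].
  have [p [Up px pv]] := Ux _ eps_gt0.
  exists u, v, (dotv (p - x) v / (1 + eps)); split=> //.
  - by split=> //; exact: boundary_far.
  - exact: divr_gt0.
  - move=> d _; rewrite ler_pdivlMr // => dp.
    split=> //; exists U; split=> //; exists p; split=> //; first exact: ltW.
    by rewrite mulrC.
move=> d x u v x' u' v' d0 de [_ fu uv] [_ gu' uv'] [fu2 [U [cU UW Ux]]].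
move=> [p [Up px pv]] [gu2' _] wd ud vd wv wv'.
have [[u1 v1 _] [u1' v1' _]] := (uv, uv').
have d16 : d <= 1 / 16 by rewrite -(ler_pM2l eps_gt0); lra.
have split_x' z w : dotv (z - x') w = dotv (z - x) w - dotv (x' - x) w.
  by rewrite -dotvNl -dotvDl opprB addrA subrK.
have shift_v z : `|dotv (z - x) v' - dotv (z - x) v| <= d * enorm (z - x).
  rewrite -dotvNr -dotvDr mulrC; apply: le_trans (cauchy_schwarz _ _) _.
  by rewrite ler_wpM2l ?enorm_ge0 // ltW.
have wv'd : dotv (x' - x) v' < d.
  exact: le_lt_trans (le_trans (ler_norm _) (dotv_unit_le _ v1')) wd.
(* [V] is the part of [U] cut off by the segment through [x'] joining its two
   feet; the discs around the feet of [x] close off the other sides. *)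
pose V := [set z | 0 < dotv (z - x) v] `&` [set z | dotv (z - x') v' < 0] `&`
  ([set z | dotv (z - x) u < eps] `&` [set z | - eps < dotv (z - x) u]).
pose V' := [set z | 0 <= dotv (z - x) v] `&` [set z | dotv (z - x') v' <= 0] `&`
  ([set z | dotv (z - x) u <= eps] `&` [set z | - eps <= dotv (z - x) u]).
(* [V] is open and [V'] closed, so this makes the common trace on [U] relatively clopen. *)
have UV : U `&` V = U `&` V'.
  rewrite eqEsubset; split=> z [Uz [[a f] [b1 b2]]]; split=> //=.
    by split; split; rewrite /= ltW.
  move: a f b1 b2 => /= a f b1 b2.
  have b : `|dotv (z - x) u| <= eps by rewrite ler_norml b1 b2.
  have zn : enorm (z - x) <= dotv (z - x) v + eps.
    by have := frame_enorm_le (z - x) uv; rewrite (ger0_norm a); lra.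
  (* Lying behind [x'] limits the height along [v'] to [d], and the tilt from [v'] to [v] is small;
     this low height excludes the lateral sides. *)
  have ae : 2 * dotv (z - x) v < eps.
    have := shift_v z; rewrite ler_norml => /andP[h _].
    rewrite split_x' in f.
    have : d * enorm (z - x) <= 1 / 16 * dotv (z - x) v + d * eps.
      apply: (le_trans (ler_wpM2l (ltW d0) zn)); rewrite mulrDr lerD2r.
      by rewrite ler_wpM2r.
    have := mulr_gt0 d0 eps_gt0; lra.
  have k1 := between_feet uv fu fu2 (UW _ Uz).
  have k2 := between_feet uv' gu' gu2' (UW _ Uz).
  have a2 : dotv (z - x) v ^+ 2 < eps ^+ 2 by rewrite ltr_sqr ?nnegrE //; lra.
  rewrite -(real_normK (num_real (dotv (z - x) u))) in k1.
  have ng0 := normr_ge0 (dotv (z - x) u).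
  (* On the base and on the segment through [x'], the component along the foot is below [2 * eps],
     against [between_feet] for [x] or [x']. On a lateral side, [between_feet] would need height
     above [eps]. *)
  split; split=> /=.
  - rewrite lt_neqAle a andbT eq_sym; apply/eqP => a0.
    by move: k1; rewrite a0 expr0n add0r expr2; nra.
  - rewrite lt_neqAle f andbT; apply/eqP => f0.
    move: k2; rewrite f0 expr0n add0r -real_normK ?num_real // expr2.
    have : `|dotv (z - x') u'| < 2 * eps.
      apply: le_lt_trans (dotv_unit_le _ u1') _.
      apply: le_lt_trans (enorm_triangle x _ _) _; rewrite (enormBC x).
      have := mulr_gt0 d0 eps_gt0; lra.
    by have := normr_ge0 (dotv (z - x') u'); nra.
  - rewrite lt_neqAle b1 andbT; apply/eqP => be.
    by move: k1; rewrite be gtr0_norm // expr2; nra.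
  - rewrite lt_neqAle b2 andbT eq_sym; apply/eqP => be.
    by move: k1; rewrite be normrN gtr0_norm // expr2; nra.
have : U `&` V = U.
  apply: cU.
  - have [|z [Uz]] := Ux (Num.min (dotv (x' - x) v') eps).
      by rewrite lt_min wv'.
    rewrite lt_min => /andP[z1 z2] zv.
    exists z; split=> //; split; split=> //=.
    + rewrite split_x' subr_lt0; apply: le_lt_trans z1.
      exact: le_trans (ler_norm _) (dotv_unit_le _ v1').
    + have := le_lt_trans (dotv_unit_le (z - x) u1) z2.
      by rewrite ltr_norml => /andP[].
    + have := le_lt_trans (dotv_unit_le (z - x) u1) z2.
      by rewrite ltr_norml => /andP[].
  - exists V => //; apply: openI; apply: openI;
      by [apply: open_gt_fun; exact: dotv_continuous
         |apply: open_lt_fun; exact: dotv_continuous].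
  - exists V' => //; apply: closedI; apply: closedI;
      by [apply: closed_ge_fun; exact: dotv_continuous
         |apply: closed_le_fun; exact: dotv_continuous].
move=> UVU; have : (U `&` V) p by rewrite UVU.
move=> [_ [[_ /=]]]; rewrite split_x' => f _.
have := shift_v p; rewrite ler_norml => /andP[h _].
have : d * enorm (p - x) <= d * eps by rewrite ler_wpM2l // ltW.
lra.
Qed.

End Counting.

(** * Outward and extremal directions *)

Section Classification.
Context {R : realType} (E : set 'rV[R]_2) (eps : R).
Hypotheses (E_compact : compact E) (eps_gt0 : 0 < eps).
Implicit Types (x y z u v w xi : 'rV[R]_2).

Local Notation foot := (foot E eps).
Local Notation outside := (outside E eps).
Local Notation bdry := (boundary (nbhd E eps)).
Local Notation outward := (outward_directions E eps).
Local Notation extremal := (extremal_directions E eps).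

Lemma boundary_nbhd x : bdry x -> nbhd E eps x.
Proof. by case=> cx _; exact: closed_closure. Qed.

Lemma outside_neq x z : bdry x -> outside z -> 0 < enorm (z - x).
Proof.
move=> bx Wz; rewrite enorm_gt0 subr_eq0; apply/eqP => zx; apply: Wz.
by rewrite zx; exact: boundary_nbhd.
Qed.

(** Multiplying by [enorm (z - x)], nonzero for outside points, clears the normalisation; choosing
    points at [k = 1 / n.+1] recovers the sequence. *)
Lemma outwardP x xi : bdry x -> outward x xi <-> enorm xi = 1 /\
  forall k : R, 0 < k -> exists z, [/\ outside z, enorm (z - x) < k &
    enorm ((z - x) - enorm (z - x) *: xi) <= k * enorm (z - x)].
Proof.
move=> bx.
have dirE z : outside z ->
    (z - x) - enorm (z - x) *: xi =
    enorm (z - x) *: ((enorm (z - x))^-1 *: (z - x) - xi).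
  by move=> Wz; rewrite scalerBr scalerA divff ?scale1r // gt_eqF // outside_neq.
split=> [[xi1 [u [Wu ux uxi]]]|[xi1 h]]; split=> //.
  move=> k k0.
  have b0 y : nbhs y (eball y k) by apply/nbhs_enorm; exists k.
  have near_x : \forall n \near \oo, eball x k (u n) := ux _ (b0 x).
  have near_xi : \forall n \near \oo,
      eball xi k ((enorm (u n - x))^-1 *: (u n - x)) := uxi _ (b0 xi).
  have [n [n1 n2]] := filter_ex (filterI near_x near_xi).
  exists (u n); split; [exact: Wu|exact: n1|].
  rewrite (dirE _ (Wu n)) // enormZ ger0_norm ?enorm_ge0 // mulrC.
  by rewrite ler_wpM2r ?enorm_ge0 // ltW.
have {}h n : exists z, [/\ outside z, enorm (z - x) < n.+1%:R^-1 &
    enorm ((z - x) - enorm (z - x) *: xi) <= n.+1%:R^-1 * enorm (z - x)].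
  by apply: h; rewrite invr_gt0 ltr0n.
have {h} [u hu] := choice h.
exists u; split=> [n||].
- by have [] := hu n.
- move=> A /nbhs_enorm[r r0 rA].
  suff : \forall n \near \oo, A (u n) by [].
  near=> n.
  apply: rA; have [_ un _] := hu n; apply: lt_trans un _.
  by near: n; exact: near_infty_natSinv_lt (PosNum r0).
- move=> A /nbhs_enorm[r r0 rA].
  suff : \forall n \near \oo, A ((enorm (u n - x))^-1 *: (u n - x)) by [].
  near=> n.
  apply: rA; have [Wu _ un] := hu n; rewrite /eball /=.
  have p := outside_neq bx Wu.
  move: un; rewrite dirE // enormZ gtr0_norm // mulrC ler_pM2r // => un.
  apply: le_lt_trans un _.
  by near: n; exact: near_infty_natSinv_lt (PosNum r0).
Unshelve. all: by end_near.
Qed.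

(** Otherwise outside points approaching along [xi] would have a component along [u] of first order,
    while [foot_ineq] makes it of second order. *)
Lemma outward_foot_le0 x u xi : bdry x -> foot x u -> outward x xi ->
  dotv u xi <= 0.
Proof.
move=> bx [u1 Eu] /(outwardP _ bx)[xi1 h]; rewrite leNgt; apply/negP => c0.
have e0 := eps_gt0.
(* The estimates below give [2 * eps * dotv u xi < k * (1 + 2 * eps)]; this [k] makes the right side
   half of the left. *)
pose k := eps * dotv u xi / (1 + 2 * eps).
have k0 : 0 < k by rewrite divr_gt0 ?mulr_gt0 //; lra.
have kE : k * (1 + 2 * eps) = eps * dotv u xi by rewrite mulfVK // gt_eqF //; lra.
have {h} [z [Wz zx zxi]] := h k k0.
have p := outside_neq bx Wz.
have := foot_ineq eps_gt0 u1 (ltW (outside_lt E_compact eps_gt0 Wz Eu)).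
rewrite -sqr_enorm; move: zx zxi p; clearbody k.
set r := enorm _; move: (z - x) @r => w r zx zxi p.
have := le_trans (dotv_le (r *: xi - w) u) (_ : _ <= k * r).
rewrite -[r *: xi - w]opprB enormN u1 mulr1 => /(_ zxi).
rewrite dotvNl dotvDl dotvNl dotvZl (dotvC xi) => i1 i2.
have : r * (2 * eps * dotv u xi) <= r * (r + 2 * eps * k).
  have : 2 * eps * (r * dotv u xi - dotv w u) <= 2 * eps * (k * r).
    by apply: ler_wpM2l; lra.
  by rewrite expr2 in i2; lra.
rewrite ler_pM2l //; have := mulr_gt0 eps_gt0 c0; lra.
Qed.

Lemma extremalP x xi : bdry x ->
  extremal x xi <-> outward x xi /\ exists2 u, foot x u & frame u xi.
Proof.
move=> bx; split=> [[oxi [y [cy yxi]]]|[oxi [u fu [_ _ uxi]]]]; split=> //.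
  have [u fu yE] := contributor_foot E_compact eps_gt0 bx cy.
  exists u => //; split; [by case: fu|by case: oxi|].
  move: yxi; rewrite yE addrAC subrr add0r dotvZl => /eqP.
  by rewrite mulf_eq0 gt_eqF //= => /eqP.
exists (x + eps *: u); split; first exact: foot_contributor.
by rewrite addrAC subrr add0r dotvZl uxi mulr0.
Qed.

(** The part of [E] at distance at least [k] from the sole contributor is compact and misses the
    circle of radius [eps] around [x]; [r] is its gap to that circle. *)
Lemma unique_foot_close x u (k : R) :
  foot x u -> (forall u', foot x u' -> u' = u) -> far E eps x -> 0 < k ->
  exists2 r : R, 0 < r & forall y, E y -> enorm (y - x) < eps + r ->
    enorm (y - (x + eps *: u)) < k.
Proof.
move=> fu uniq fx k0.
pose K := E `&` [set y | k <= enorm (y - (x + eps *: u))].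
have cK : compact K.
  by apply: compact_closedI => //; apply: closed_ge_fun; exact: enorm_continuous.
have [K0|K0] := pselect (K !=set0); last first.
  exists 1 => // y Ey _; rewrite ltNge; apply/negP => ky.
  by apply: K0; exists y.
have [y [Ey ky] ymin] := compact_nearest x cK K0.
have lt_y : eps < enorm (y - x).
  rewrite lt_neqAle fx // andbT; apply/eqP => ye.
  have yE : y = x + eps *: (eps^-1 *: (y - x)).
    by rewrite scalerA mulfV ?gt_eqF // scale1r addrCA subrr addr0.
  move: ky; rewrite /= {1}yE (uniq (eps^-1 *: (y - x))).
    by rewrite subrr enorm0 leNgt k0.
  split; last by rewrite -yE.
  by rewrite enormZ -ye gtr0_norm ?invr_gt0 // mulVf // gt_eqF.
exists (enorm (y - x) - eps); first by rewrite subr_gt0.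
move=> y' Ey'; rewrite addrCA subrr addr0 => y'x; rewrite ltNge; apply/negP => ky'.
by have := ymin y' (conj Ey' ky'); rewrite leNgt y'x.
Qed.

(** Near [x] only points of [E] close to the sole contributor matter, and a step along [v] tilted
    slightly away from [u] leaves the discs around all of them. *)
Lemma unique_foot_outward x u v : bdry x -> foot x u ->
  (forall u', foot x u' -> u' = u) -> frame u v -> outward x v.
Proof.
move=> bx fu uniq uv; apply/outwardP => //; have [u1 v1 uv0] := uv; split=> // k k0.
(* The tilt [s] away from the foot makes the segment from [x] leave the offset. *)
have [s [s0 s1 sk]] : exists s : R, [/\ 0 < s, s <= 1 & 2 * s <= k].
  exists (Num.min 1 (k / 2)); split; first by rewrite lt_min ltr01 divr_gt0.
    by rewrite ge_min lexx.
  have : Num.min 1 (k / 2) <= k / 2 by rewrite ge_min lexx orbT.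
  lra.
pose d := v - s *: u.
have dd : dotv d d = 1 + s ^+ 2.
  rewrite /d !dotv_lin (dotvC v u) uv0 (unitP u1) (unitP v1); ring.
have du : dotv d u = - s.
  by rewrite /d !dotv_lin (dotvC v u) uv0 (unitP u1); ring.
have dv : enorm (d - v) = s.
  by rewrite /d addrAC subrr add0r enormN enormZ u1 mulr1 gtr0_norm.
have d1 : 1 <= enorm d by rewrite enorm_ge_sqr // dd expr1n lerDl sqr_ge0.
have d2 : enorm d <= 1 + s.
  by rewrite enorm_le_sqr ?addr_ge0 ?(ltW s0) // dd sqrrD expr1n; lra.
clearbody d.
have [r r0 hr] := unique_foot_close fu uniq (boundary_far E_compact eps_gt0 bx)
  (divr_gt0 (mulr_gt0 eps_gt0 s0) (ltr0Sn _ 1)).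
have [t [t0 tk tr]] : exists t : R, [/\ 0 < t, t * 2 < k & t * 2 < r].
  exists (Num.min k r / 4); split.
  - by rewrite divr_gt0 // lt_min k0.
  - have : Num.min k r <= k by rewrite ge_min lexx.
    lra.
  - have : Num.min k r <= r by rewrite ge_min lexx orbT.
    lra.
have td : t * enorm d <= t * 2 by rewrite ler_pM2l //; lra.
have zx : x + t *: d - x = t *: d by rewrite addrAC subrr add0r.
have zn : enorm (x + t *: d - x) = t * enorm d.
  by rewrite zx enormZ gtr0_norm.
exists (x + t *: d); split; last 2 first.
- by rewrite zn; exact: le_lt_trans td tk.
- rewrite zn zx -scalerA -scalerBr enormZ gtr0_norm // mulrCA ler_pM2l //.
  have -> : d - enorm d *: v = (d - v) - (enorm d - 1) *: v.
    by apply/rowP => i; rewrite !mxE; ring.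
  apply: le_trans (ler_enormD _ _) _.
  rewrite enormN enormZ v1 mulr1 dv ger0_norm ?subr_ge0 //.
  by apply: (@le_trans _ _ (k * 1)); [lra|rewrite ler_pM2l].
move=> /(nbhdP E_compact eps_gt0)[y Ey yz].
have yx : enorm (y - x) < eps + r.
  apply: le_lt_trans (enorm_triangle (x + t *: d) _ _) _.
  by rewrite zn; lra.
have := hr y Ey yx; have := boundary_far E_compact eps_gt0 bx Ey.
move: yz.
have -> : y - (x + t *: d) = (y - x) - t *: d.
  by apply/rowP => i; rewrite !mxE; ring.
have -> : y - (x + eps *: u) = (y - x) - eps *: u.
  by apply/rowP => i; rewrite !mxE; ring.
move: (y - x) => w.
rewrite enorm_le_sqr ?(ltW eps_gt0) // enorm_ge_sqr ?(ltW eps_gt0) // => h1 h2 h3.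
(* This error is offset by [dotv (eps *: u) d = - eps * s], so [dotv w d <= 0] and moving from [x]
   along [d] increases the distance to [y]. *)
have : dotv (w - eps *: u) d <= eps * s.
  apply: le_trans (dotv_le _ _) _.
  have := ler_wpM2r (enorm_ge0 d) (ltW h3).
  have : eps * s / 2 * enorm d <= eps * s / 2 * 2.
    by rewrite ler_pM2l ?divr_gt0 ?mulr_gt0 //; lra.
  lra.
rewrite dotvDl dotvNl dotvZl (dotvC u) du => h4.
have : dotv w d <= 0 by lra.
apply/negP; rewrite -ltNge -(pmulr_rgt0 _ t0).
move: h1; rewrite dotvDl dotvNl !dotvDr !dotvNr !dotvZl !dotvZr (dotvC d w) => h1.
have : 0 < t * (t * dotv d d) by rewrite !mulr_gt0 // dd ltr_pwDl // sqr_ge0.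
lra.
Qed.

(** The two tangent discs confine outside points near [x] to directions close to [xi] or [- xi];
    those behind [x] select [- xi]. *)
Lemma outward_opp x u xi : bdry x -> foot x u -> foot x (- u) -> frame u xi ->
  (forall r : R, 0 < r -> exists z, [/\ outside z, enorm (z - x) < r &
     dotv (z - x) xi < 0]) ->
  outward x (- xi).
Proof.
move=> bx fu fu' uxi h; apply/outwardP => //.
have [u1 xi1 _] := uxi; split; first by rewrite enormN.
move=> k k0.
have [|z [Wz]] := h (Num.min k (k * eps)); first by rewrite lt_min k0 mulr_gt0.
rewrite lt_min => /andP[zx1 zx2] zxi; exists z; split=> //.
have foot_le v : foot x v -> 2 * eps * dotv (z - x) v <= enorm (z - x) ^+ 2.
  move=> [v1 Ev]; rewrite sqr_enorm; apply: foot_ineq => //.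
  exact: (ltW (outside_lt E_compact eps_gt0 Wz Ev)).
have := foot_le _ fu; have := foot_le _ fu'.
have p := outside_neq bx Wz.
have i0 := frame_sqr_enorm (z - x) uxi; rewrite -sqr_enorm in i0.
move: zx2 zxi p i0; move: (z - x) => w.
set r := enorm w; rewrite dotvNr => wr wxi r0 i0 i1 i2.
have rb : 2 * `|dotv w u| <= k * r.
  rewrite -(ler_pM2l eps_gt0).
  have : r ^+ 2 <= k * eps * r by rewrite expr2 ler_wpM2r // ltW.
  have [?|?] := leP 0 (dotv w u); [rewrite ger0_norm //|rewrite ltr0_norm //]; lra.
have ra : 0 <= r + dotv w xi <= `|dotv w u|.
  have b0 := normr_ge0 (dotv w u).
  rewrite -(real_normK (num_real (dotv w u))) in i0.
  apply/andP; split; nra.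
rewrite scalerN opprK.
have := frame_enorm_le (w + r *: xi) uxi.
have [_ _ uxi0] := uxi.
rewrite !dotvDl !dotvZl (dotvC xi u) uxi0 mulr0 addr0 (unitP xi1) mulr1.
case/andP: ra => ra1 ra2; rewrite (addrC _ r) (ger0_norm ra1); lra.
Qed.

End Classification.

Lemma countable_setU {T} (A B : set T) :
  countable A -> countable B -> countable (A `|` B).
Proof.
move=> cA cB; rewrite -bigcup2E; apply: bigcup_countable => // -[|[|i]] _ //=.
Qed.

(** * The types of singularities *)

Section Types.
Context {R : realType} (E : set 'rV[R]_2) (eps : R).
Hypotheses (E_compact : compact E) (eps_gt0 : 0 < eps).
Implicit Types (x y z u v w xi : 'rV[R]_2).

Local Notation foot := (foot E eps).
Local Notation outside := (outside E eps).
Local Notation bdry := (boundary (nbhd E eps)).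
Local Notation outward := (outward_directions E eps).
Local Notation extremal := (extremal_directions E eps).

(** Equal or opposite feet are orthogonal to the same line, so the two extremal directions would be
    equal or opposite. *)
Lemma wedge_corner : wedge E eps `<=` corners E eps.
Proof.
move=> x [[bx _] [xi1 [xi2 [ext n1 n2]]]]; split=> //.
have /(extremalP E_compact eps_gt0 _ bx)[xi_out1 [u fu uxi]] : extremal x xi1.
  by rewrite ext; left.
have /(extremalP E_compact eps_gt0 _ bx)[xi_out2 [u' fu' uxi']] : extremal x xi2.
  by rewrite ext; right.
exists u, u'; have [u1' xi21 u'xi2] := uxi'.
split=> // u'u; rewrite u'u in u'xi2.
  have [] := frame_parallel (frameC uxi) xi21; first by rewrite dotvC.
    by move=> h; apply: n1; rewrite h.
  by move=> h; apply: n2; rewrite h opprK.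
have [] := frame_parallel (frameC uxi) xi21.
- by rewrite dotvC; move: u'xi2; rewrite dotvNl => /eqP; rewrite oppr_eq0 => /eqP.
- by move=> h; apply: n1; rewrite h.
- by move=> h; apply: n2; rewrite h opprK.
Qed.

(** Since [- xi] would be extremal too, it is not outward. Away from corners the feet are [u] and
    possibly [- u]: a sole foot contradicts [unique_foot_outward], and with both feet outside points
    behind [x] at every scale contradict [outward_opp]. *)
Lemma single_extremal x xi : bdry x -> extremal x = [set xi; xi] ->
  corners E eps x \/ one_sided E eps x.
Proof.
move=> bx ext; rewrite setUid in ext.
have /(extremalP E_compact eps_gt0 _ bx)[xi_out [u fu uxi]] : extremal x xi.
  by rewrite ext.
have xi_nopp : ~ outward x (- xi).
  move=> Nxi_out; have : extremal x (- xi).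
    apply/extremalP => //; split=> //; exists u => //; exact: frameNr.
  rewrite ext /= => e; have [_ /unitP + _] := uxi.
  by rewrite -{1}e dotvNl => e1; have := dotvv_ge0 xi; lra.
have [cx|ncx] := pselect (corners E eps x); [by left|right].
have feet u' : foot x u' -> u' = u \/ u' = - u.
  move=> fu'; apply: contrapT => /not_orP[n1 n2]; apply: ncx.
  by split=> //; exists u, u'.
have [fu'|nfu'] := pselect (foot x (- u)); last first.
  exfalso; apply: xi_nopp; apply: (unique_foot_outward _ _ bx fu) => //.
    by move=> u' fu'; case: (feet _ fu') => // e; rewrite e in fu'.
  exact: frameNr.
apply: contrapT => nos; apply: xi_nopp; apply: (outward_opp _ _ bx fu) => //.
move=> r r0; apply: contrapT => h; apply: nos; split=> //.
exists u, xi, r; split=> // z Wz zx; rewrite leNgt; apply/negP => zxi.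
by apply: h; exists z.
Qed.

(** By [outward_foot_le0] for both directions, every foot is orthogonal to [xi]. *)
Lemma opposite_extremal x xi : bdry x -> extremal x xi -> extremal x (- xi) ->
  exists u, [/\ foot x u, frame u xi &
                forall u', foot x u' -> u' = u \/ u' = - u].
Proof.
move=> bx /(extremalP E_compact eps_gt0 _ bx)[xi_out [u fu uxi]].
move=> /(extremalP E_compact eps_gt0 _ bx)[Nxi_out _].
exists u; split=> // u' fu'; apply: (frame_parallel uxi); first by case: fu'.
apply/eqP; rewrite eq_le (outward_foot_le0 E_compact eps_gt0 bx fu' xi_out) /=.
by have := outward_foot_le0 E_compact eps_gt0 bx fu' Nxi_out; rewrite dotvNr oppr_le0.
Qed.

Lemma half_ball_cusp x u xi d : bdry x -> outward x xi ->
  foot x u -> foot x (- u) -> frame u xi -> 0 < d ->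
  connected (half_ball d x xi `\` nbhd E eps) -> cusps E eps x.
Proof.
move=> bx xi_out fu fu' uxi d0 cU; split=> //.
exists u, xi, (half_ball d x xi `\` nbhd E eps); split=> //.
split=> // r r0.
(* The bound [1 / 2] on the angular error keeps [z] strictly in front of [x]. *)
have [xi1 /(_ (Num.min (Num.min d r) (1 / 2)))[|z [Wz]]] :=
  (outwardP xi bx).1 xi_out.
  by rewrite !lt_min d0 r0 divr_gt0.
rewrite !lt_min => /andP[/andP[zd zr] _] zxi.
have p := outside_neq bx Wz.
have zv : 0 < dotv (z - x) xi.
  have zxi2 : enorm (z - x - enorm (z - x) *: xi) <= 1 / 2 * enorm (z - x).
    by apply: le_trans zxi _; rewrite ler_pM2r // ge_min lexx orbT.
  have := le_trans (dotv_unit_le _ xi1) zxi2.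
  move: p {zxi zxi2 zd zr}; move: (z - x) => w p.
  by rewrite dotvDl dotvNl dotvZl (unitP xi1) ler_norml => /andP[]; lra.
by exists z; split=> //; split.
Qed.

Lemma sharp_sharp_cusp : sharp_sharp E eps `<=` cusps E eps.
Proof.
move=> x [[bx _] [xi1 [xi2 [ext nU xi12 [d [d0 cU]] _]]]].
have e1 : extremal x xi1 by rewrite ext; left.
have e2 : extremal x (- xi1) by rewrite ext xi12 opprK; right.
have [u [fu uxi feet]] := opposite_extremal bx e1 e2.
have fu' : foot x (- u).
  apply: contrapT => nfu; apply: nU; split=> //; exists (x + eps *: u).
  rewrite eqEsubset; split=> y /=; last first.
    by move=> ->; exact: foot_contributor.
  move=> /(contributor_foot E_compact eps_gt0 bx)[u' fu' ->].
  by case: (feet _ fu') => e; rewrite e // in fu' *.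
by apply: (half_ball_cusp bx _ fu fu' uxi d0 cU); case: e1.
Qed.

(** If [u] were the only foot, the contributors of [s n] would approach [x + eps *: u]. The vectors
    to two of them would then be less than [eps] apart, whereas vectors of length [eps] with
    negative inner product are farther apart. *)
Lemma opposite_contributors_feet x u (s : nat -> 'rV[R]_2) : bdry x ->
  foot x u -> (forall n, bdry (s n)) -> s @ \oo --> x ->
  opposite_contributors E eps s -> exists2 u', foot x u' & u' <> u.
Proof.
move=> bx fu bs sx [y1 [y2 [ys lim]]]; apply: contrapT => nex.
have uniq u' : foot x u' -> u' = u.
  by move=> fu'; apply: contrapT => ?; apply: nex; exists u'.
have k0 : 0 < eps / 4 by rewrite divr_gt0.
have [r r0 close] := unique_foot_close E_compact eps_gt0 fu uniq
  (boundary_far E_compact eps_gt0 bx) k0.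
have near_x : \forall n \near \oo, eball x (Num.min r (eps / 4)) (s n).
  by apply: sx; apply/nbhs_enorm; exists (Num.min r (eps / 4)) => //;
     rewrite lt_min r0.
have near_dot : \forall n \near \oo,
    dotv (eps^-1 *: (y1 n - s n)) (eps^-1 *: (y2 n - s n)) < 0.
  by apply: (cvgr_lt (-1 : R)) => //; rewrite oppr_lt0.
have [n [snx dot_lt0]] := filter_ex (filterI near_x near_dot).
move: snx; rewrite /eball /= lt_min => /andP[sr s4].
have near_foot y : extremal_contributors E eps (s n) y ->
    [/\ enorm (y - s n) = eps & enorm (y - s n - eps *: u) < eps / 2].
  move=> [/(contributorsP E_compact eps_gt0 _ (bs n))[Ey ysn] _]; split=> //.
  have : enorm (y - (x + eps *: u)) < eps / 4.
    apply: close => //; apply: le_lt_trans (enorm_triangle (s n) _ _) _.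
    by rewrite ysn ltrD2l.
  have -> : y - (x + eps *: u) = (y - s n - eps *: u) + (s n - x).
    by apply/rowP => i; rewrite !mxE; ring.
  move=> h.
  have := ler_enormD (y - s n - eps *: u + (s n - x)) (- (s n - x)).
  by rewrite addrK enormN; lra.
have [a1 a2] : [/\ enorm (y1 n - s n) = eps & enorm (y1 n - s n - eps *: u) < eps / 2].
  by apply: near_foot; rewrite ys; left.
have [b1 b2] : [/\ enorm (y2 n - s n) = eps & enorm (y2 n - s n - eps *: u) < eps / 2].
  by apply: near_foot; rewrite ys; right.
move: a1 a2 b1 b2 dot_lt0.
rewrite !dotvZl !dotvZr !pmulr_rlt0 ?invr_gt0 //.
move: (y1 n - s n) (y2 n - s n) => a b a1 a2 b1 b2 ab.
have : enorm (a - b) < eps.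
  have -> : a - b = (a - eps *: u) - (b - eps *: u).
    by apply/rowP => i; rewrite !mxE; ring.
  by apply: le_lt_trans (ler_enormD _ _) _; rewrite enormN; lra.
rewrite enorm_lt_sqr ?(ltW eps_gt0) // dotvDl dotvNl !dotvDr !dotvNr.
rewrite -!sqr_enorm a1 b1 (dotvC b a).
by have := sqr_ge0 eps; lra.
Qed.

(** The chain of singularities supplies a second foot, which can only be [- u]. *)
Lemma sharp_chain_cusp : sharp_chain E eps `<=` cusps E eps.
Proof.
move=> x [[bx _] [xi1 [xi2 [ext xi12 [d [d0 cU]] [d2 [s [_ ss sx opp]]]]]]].
have e1 : extremal x xi1 by rewrite ext; left.
have e2 : extremal x (- xi1) by rewrite ext xi12 opprK; right.
have [u [fu uxi feet]] := opposite_extremal bx e1 e2.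
have bs n : bdry (s n) by have [_ []] := ss n.
have [u' fu' u'u] := opposite_contributors_feet bx fu bs sx opp.
case: (feet u' fu') => // e; rewrite e in fu'.
by apply: (half_ball_cusp bx _ fu fu' uxi d0 cU); case: e1.
Qed.

Lemma one_sided_shallow_shallow : one_sided_shallow E eps `<=` shallow E eps.
Proof.
move=> x [sx [xi1 [xi2 [ext _ [d [d0 hd]] _]]]]; split=> //.
have [bx _] := sx.
have /(extremalP E_compact eps_gt0 _ bx)[_ [u fu uxi]] : extremal x xi1.
  by rewrite ext; left.
by exists u, xi1, d.
Qed.

Lemma one_sided_sharp_or_chain :
  one_sided_sharp E eps `|` one_sided_chain E eps `<=`
  corners E eps `|` one_sided E eps.
Proof.
by move=> x [] [[bx _] [xi1 [xi2 [ext xi12 _]]]];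
   apply: (@single_extremal _ xi1) => //; rewrite ext -xi12.
Qed.

End Types.

Theorem theorem2 (R : realType) (E : set 'rV[R]_2) (eps : R)
    (E_compact : compact E) (eps_gt0 : 0 < eps) :
  countable (wedge E eps `|`
             (one_sided_sharp E eps `|` sharp_sharp E eps
                `|` sharp_chain E eps) `|`
             one_sided_shallow E eps `|`
             one_sided_chain E eps).
Proof.
apply: (@sub_countable _ _ _ (corners E eps `|` one_sided E eps `|`
                              cusps E eps `|` shallow E eps)).
  apply: subset_card_le => x.
  move=> [[[/(wedge_corner E_compact eps_gt0) h|
    [[h|/(sharp_sharp_cusp E_compact eps_gt0) h]|
     /(sharp_chain_cusp E_compact eps_gt0) h]]|
     /(one_sided_shallow_shallow E_compact eps_gt0) h]|h].
  - by left; left; left.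
  - by left; left; apply: (one_sided_sharp_or_chain E_compact eps_gt0); left.
  - by left; right.
  - by left; right.
  - by right.
  - by left; left; apply: (one_sided_sharp_or_chain E_compact eps_gt0); right.
by do 3?apply: countable_setU;
  [exact: countable_corners|exact: countable_one_sided
  |exact: countable_cusps|exact: countable_shallow].
Qed.
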